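(* Let $X_1,X_2$ be finite candidate sets of products with profits $r_i$ and valuations $0<v_i<1$, and let $\mathbf{S}^*=(S_1^*,S_2^* )$ be an optimal two-tier offering, i.e. a maximizer of $E[R(\mathbf{S})]$ over all $\mathbf{S}=(S_1,S_2)$ with $S_1\subseteq X_1$, $S_2\subseteq X_2$. Let $m\notin X_1\cup X_2$ be a new product with valuation $0<v_m<1$ and profit $r_m<E[R(S_2^* )]$. Let $G^{(1)}(\mathbf{S},\mathbf{v})$ and $G^{(2)}(\mathbf{S},\mathbf{v})$ be the one-epoch regrets when $m$ is added to the first tier and to the second tier of $\mathbf{S}$, respectively (defined in the context). Then the solutions $\mathbf{Q}^*=\operatorname{argmin}_{\mathbf{S}}G^{(1)}(\mathbf{S},\mathbf{v})$ and $\mathbf{Q}'^*=\operatorname{argmin}_{\mathbf{S}}G^{(2)}(\mathbf{S},\mathbf{v})$, with minimization over $S_1\subseteq X_1$, $S_2\subseteq X_2$, are the same as the optimal offering: $\mathbf{Q}^*=\mathbf{Q}'^*=\mathbf{S}^*$ (if optimizers are not unique: the sets of minimizers of $G^{(1)}$ and of $G^{(2)}$ both equal the set of optimal two-tier offerings). In addition, $$G^{(1)}(\mathbf{S}^*,\mathbf{v})\ge G^{(2)}(\mathbf{S}^*,\mathbf{v})=v_m\big(E[R(S_2^* )]-r_m\big).$$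
   Context: Two-tier sequential multinomial logit model: independently across times $t$, a customer offered $(S_1,S_2)$ first considers $S_1$, buying $i\in S_1$ with probability $v_i/(1+\sum_{j\in S_1}v_j)$; if nothing is bought from $S_1$, she considers $S_2$, buying $i\in S_2$ with conditional probability $v_i/(1+\sum_{j\in S_2}v_j)$; otherwise she buys nothing. $R_t(\mathbf{S},\mathbf{v})$ is the profit earned at time $t$ when $\mathbf{S}$ is offered ($r_i$ if $i$ is bought, $0$ if nothing is). The expected profit is $$E[R(\mathbf{S})]=\frac{\sum_{i\in S_1}r_iv_i}{1+\sum_{i\in S_1}v_i}+\frac{1}{1+\sum_{i\in S_1}v_i}\cdot\frac{\sum_{i\in S_2}r_iv_i}{1+\sum_{i\in S_2}v_i},$$ and for a single set $S$, $E[R(S)]=\frac{\sum_{i\in S}r_iv_i}{1+\sum_{i\in S}v_i}$. For $\mathbf{S}=(S_1,S_2)$ set $\mathbf{S}'=(S_1\cup\{m\},S_2)$ and $\mathbf{S}''=(S_1,S_2\cup\{m\})$. $G^{(1)}(\mathbf{S},\mathbf{v})=E\left[\sum_{t=1}^{N_1}\big(R_t(\mathbf{S}^*,\mathbf{v})-R_t(\mathbf{S}',\mathbf{v})\big)\right]$, where $N_1$ is the number of customers to whom $\mathbf{S}'$ is offered up to and including the first one who buys nothing from its first tier $S_1\cup\{m\}$; $N_1$ is geometric with mean $1+\sum_{j\in S_1\cup\{m\}}v_j$. $G^{(2)}(\mathbf{S},\mathbf{v})=E\left[\sum_{t=1}^{N_2}\big(R_t(\mathbf{S}^*,\mathbf{v})-R_t(\mathbf{S}'',\mathbf{v})\big)\right]$,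 where $N_2$ is the number of customers to whom $\mathbf{S}''$ is offered up to and including the first one who buys nothing from either tier; $N_2$ is geometric with mean $(1+\sum_{j\in S_1}v_j)(1+\sum_{j\in S_2\cup\{m\}}v_j)$. The comparison with $\mathbf{S}^*$ at each time is with respect to customers that are i.i.d. over time, so that the expected benchmark profit per time step is $E[R(\mathbf{S}^* )]$ independently of the stopping rule, i.e. $E[\sum_{t=1}^{N_k}R_t(\mathbf{S}^*,\mathbf{v})]=E[N_k]\,E[R(\mathbf{S}^* )]$. *)

(* Defs.v *)
From HB Require Import structures.
From mathcomp Require Import all_boot all_order all_algebra.
From mathcomp Require Import all_classical all_reals all_analysis.

Set Implicit Arguments.
Unset Strict Implicit.
Unset Printing Implicit Defensive.

Import Order.TTheory GRing.Theory Num.Theory.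
Import numFieldNormedType.Exports.

Local Open Scope classical_set_scope.
Local Open Scope ring_scope.

(* A two-tier offering (S_1, S_2) of products of K; the tiers may overlap. *)
Notation offering K := ({set K} * {set K})%type.

(* What a customer buys: [Some (inl i)] is product i from the first tier,
   [Some (inr i)] product i from the second tier, [None] nothing.  The tier is
   recorded because a product may be present in both. *)
Notation outcome K := (option (K + K)).

(* The behaviour of one customer: her outcome for each possible offering.  The
   joint law of the outcomes for different offerings is left unconstrained. *)
Notation customer K := {ffun offering K -> outcome K}.

Section Model.
Variables (R : realType) (K : finType) (r v : K -> R).
Implicit Types (S : {set K}) (SS : offering K).

Definition profit1 S : R :=
  (\sum_(i in S) r i * v i) / (1 + \sum_(i in S) v i).

Definition profit2 SS : R :=
  (\sum_(i in SS.1) r i * v i) / (1 + \sum_(i in SS.1) v i)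
  + (1 + \sum_(i in SS.1) v i)^-1
    * ((\sum_(i in SS.2) r i * v i) / (1 + \sum_(i in SS.2) v i)).

Definition feasible (X1 X2 : {set K}) : set (offering K) :=
  [set SS : offering K | SS.1 \subset X1 /\ SS.2 \subset X2].

Definition optimal_offerings (X1 X2 : {set K}) : set (offering K) :=
  [set SS : offering K | feasible X1 X2 SS /\
            forall SS', feasible X1 X2 SS' -> profit2 SS' <= profit2 SS].

Definition argmin_offerings (X1 X2 : {set K}) (G : offering K -> \bar R) :
    set (offering K) :=
  [set SS : offering K | feasible X1 X2 SS /\
            forall SS', feasible X1 X2 SS' -> (G SS <= G SS')%E].

Definition mnl_buy S (i : K) : R :=
  if i \in S then v i / (1 + \sum_(j in S) v j) else 0.

Definition mnl_none S : R := (1 + \sum_(j in S) v j)^-1.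

Definition smnl_prob SS (o : outcome K) : R :=
  match o with
  | Some (inl i) => mnl_buy SS.1 i
  | Some (inr i) => mnl_none SS.1 * mnl_buy SS.2 i
  | None => mnl_none SS.1 * mnl_none SS.2
  end.

Definition profit_of (o : outcome K) : R :=
  match o with
  | Some (inl i) | Some (inr i) => r i
  | None => 0
  end.

Definition none_from_tier1 (o : outcome K) : bool :=
  if o is Some (inl _) then false else true.

Definition none_from_either (o : outcome K) : bool := o == None.

Definition add_tier1 (m : K) SS : offering K := (m |: SS.1, SS.2)%SET.
Definition add_tier2 (m : K) SS : offering K := (SS.1, m |: SS.2)%SET.

(* Number of steps up to and including the first t with [stop t]; time starts
   at 0.  The value 0 when [stop] never holds is a convention (in the model
   below that event is negligible). *)
Definition epoch_length (stop : nat -> bool) : nat :=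
  if pselect (exists t, stop t) is left h then (ex_minn h).+1 else 0%N.

Section Probability.
Context (d : measure_display) (T : measurableType d) (P : probability T R).
Variable c : nat -> T -> customer K.

(* The customers [c 0], [c 1], ... are i.i.d. and each one follows the
   two-tier multinomial logit model.  As [customer K] is a finite type, events
   about customer t are the preimages of its subsets. *)
Record iid_smnl_customers : Prop := {
  customers_measurable : forall t (A : {set customer K}),
    measurable [set w | c t w \in A];
  customers_independent : forall (J : seq nat) (A : nat -> {set customer K}),
    uniq J ->
    P (\bigcap_(t in [set` J]) [set w | c t w \in A t])
      = (\prod_(t <- J) P [set w | c t w \in A t])%E;
  customers_identical : forall t u (A : {set customer K}),
    P [set w | c t w \in A] = P [set w | c u w \in A];
  customers_smnl : forall t SS (o : outcome K),
    P [set w | c t w SS = o] = (smnl_prob SS o)%:E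
}.

Definition profit_at (t : nat) SS (w : T) : R := profit_of (c t w SS).

(* Expected total shortfall, with respect to [Sopt], of offering [SS] up to and
   including the first customer whose outcome satisfies [stop]. *)
Definition epoch_regret (stop : outcome K -> bool) (Sopt SS : offering K) :
    \bar R :=
  'E_P[fun w => (\sum_(t < epoch_length (fun t => stop (c t w SS)))
                  (profit_at t Sopt w - profit_at t SS w))%R]%E.

Definition regret1 (m : K) (Sopt SS : offering K) : \bar R :=
  epoch_regret none_from_tier1 Sopt (add_tier1 m SS).

Definition regret2 (m : K) (Sopt SS : offering K) : \bar R :=
  epoch_regret none_from_either Sopt (add_tier2 m SS).

End Probability.
End Model.

(* Main.v *)
(* By Wald's identity the one-epoch regret of S' (resp. S'') is the gap between
   the optimal profit rho and its expected profit, times the mean epoch length.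
   With w1, w2 the total valuations of the tiers of S, clearing denominators:
     G1 S = (1 + w1) (rho - E[R S]) + v_m (rho - r_m),
     G2 S = (1 + w1) (1 + w2) (rho - E[R S])
            + v_m ((1 + w1) rho - sum_(i in S_1) r_i v_i - r_m).
   The first summands vanish exactly at the optimal offerings.  In G2, optimality
   of S* against (S_1, S_2* ) gives
     (1 + w1) rho - sum_(i in S_1) r_i v_i >= E[R S_2*],
   with equality when S is optimal, and comparing S* with (empty, S_2* ) gives
   rho >= E[R S_2*]. *)
Require Import Defs.
From HB Require Import structures.
From mathcomp Require Import all_boot all_order all_algebra.
From mathcomp Require Import all_classical all_reals all_analysis.
From mathcomp Require Import measurable_realfun.
From mathcomp Require Import ring lra.
Set Implicit Arguments.
Unset Strict Implicit.
Unset Printing Implicit Defensive.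
Import Order.TTheory GRing.Theory Num.Theory.
Import numFieldNormedType.Exports.
Local Open Scope classical_set_scope.
Local Open Scope ring_scope.

(** * Length of an epoch *)

(** Makes the term at time [t] of a stopped sum depend, through the stopping rule, only on what
    happened strictly before [t]. *)
Lemma ltn_epoch_length (stop : nat -> bool) (t : nat) :
  (exists s, stop s) ->
  (t < epoch_length stop)%N <-> (forall s, (s < t)%N -> ~~ stop s).
Proof.
move=> ex_stop; rewrite /epoch_length; case: pselect => // h.
case: ex_minnP => k stop_k k_min; rewrite ltnS; split => [le_tk s lt_st|no_stop].
  by apply/negP => /k_min; rewrite leqNgt (leq_trans lt_st le_tk).
by rewrite leqNgt; apply/negP => /no_stop; rewrite stop_k.
Qed.

Lemma epoch_length0 (stop : nat -> bool) :
  ~ (exists t, stop t) -> epoch_length stop = 0%N.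
Proof. by rewrite /epoch_length; case: pselect. Qed.

(** * Integrals of functions of a finite-valued random variable *)

Section FiniteRandomVariable.
Context (R : realType) (d : measure_display) (T : measurableType d).
Context (P : probability T R) (U : finType) (X : T -> U).
Hypothesis mX : forall a : U, measurable [set w | X w = a].

Let term (f : U -> R) (E : set T) (a : U) (w : T) : \bar R :=
  ((f a)%:E * (\1_(E `&` [set w | X w = a]) w)%:E)%E.

(** Splitting along the level sets of [X] turns the integrand into a finite combination of
    indicators. *)
Let sum_term (f : U -> R) (E : set T) :
  (fun w => (f (X w) * \1_E w)%:E) = (fun w => \sum_a term f E a w)%E.
Proof.
apply/funext => w; rewrite (bigD1 (X w)) //= big1 ?adde0; last first.
  move=> a aX; rewrite /term indicE memNset ?mule0 //= => -[_ /esym/eqP].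
  by rewrite (negbTE aX).
rewrite /term -EFinM; congr (_ * _)%:E.
by rewrite !indicE in_setI [X in _ && X]mem_set ?andbT.
Qed.

Let mterm (E : set T) a : measurable E ->
  measurable (E `&` [set w | X w = a]).
Proof. by move=> mE; exact: measurableI. Qed.

Let int_term (f : U -> R) (E : set T) a : measurable E ->
  P.-integrable setT (term f E a).
Proof.
move=> mE; apply: integrableZl => //.
by apply: integrable_indic => //; exact: mterm.
Qed.

Lemma integrable_finite_rv (f : U -> R) (E : set T) : measurable E ->
  P.-integrable setT (fun w => (f (X w) * \1_E w)%:E).
Proof.
move=> mE; rewrite sum_term; apply: integrable_sum => // a _.
exact: int_term.
Qed.

Lemma integral_finite_rv (f : U -> R) (E : set T) : measurable E ->
  (\int[P]_w (f (X w) * \1_E w)%:E =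
   (\sum_a f a * fine (P (E `&` [set w | X w = a])))%:E)%E.
Proof.
move=> mE; rewrite sum_term integral_sum //; last by move=> a; exact: int_term.
rewrite -sumEFin; apply: eq_bigr => a _.
rewrite integralZl //; last first.
  by apply: integrable_indic => //; exact: mterm.
rewrite integral_indic ?setIT //; last exact: mterm.
by rewrite EFinM fineK // fin_num_measure //; exact: mterm.
Qed.

Lemma prob_finite_rv (B : {set U}) :
  measurable [set w | X w \in B] ->
  fine (P [set w | X w \in B]) = \sum_(a in B) fine (P [set w | X w = a]).
Proof.
move=> mB; have := integral_finite_rv (fun a => (a \in B)%:R) measurableT.
under eq_integral => w _.
  rewrite indicT /cst mulr1 (_ : _%:R = \1_[set w | X w \in B] w); last first.
    by rewrite indicE; congr (nat_of_bool _)%:R; apply/idP/idP => [/mem_set//|/set_mem].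
  over.
rewrite integral_indic // setIT => ->; rewrite /= [RHS]big_mkcond /=.
by apply: eq_bigr => a _; rewrite setTI; case: ifP; rewrite ?mul1r ?mul0r.
Qed.

End FiniteRandomVariable.

(** * Wald's identity for an i.i.d. finite-valued sequence *)

Section Wald.
Context (R : realType) (d : measure_display) (T : measurableType d).
Context (P : probability T R) (U : finType) (X : nat -> T -> U).
Hypothesis mX : forall t (A : {set U}), measurable [set w | X t w \in A].
Hypothesis indepX : forall (J : seq nat) (A : nat -> {set U}), uniq J ->
  P (\bigcap_(t in [set` J]) [set w | X t w \in A t])
    = (\prod_(t <- J) P [set w | X t w \in A t])%E.
Hypothesis identX : forall t u (A : {set U}),
  P [set w | X t w \in A] = P [set w | X u w \in A].
Variable stop : U -> bool.

Let p (a : U) : R := fine (P [set w | X 0%N w = a]).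
Let pstop : R := \sum_(a | stop a) p a.
Hypothesis pstop_gt0 : 0 < pstop.

Let q : R := \sum_(a | ~~ stop a) p a.

Let mX1 t a : measurable [set w | X t w = a].
Proof.
rewrite (_ : [set _ | _] = [set w | X t w \in [set a]%SET]) //.
by apply/seteqP; split => w /=; rewrite inE => /eqP.
Qed.

Let pX t (A : {set U}) : P [set w | X t w \in A] = (\sum_(a in A) p a)%:E.
Proof.
by rewrite (identX t 0) -prob_finite_rv // fineK // fin_num_measure.
Qed.

Let sum_setT : \sum_(a in [set: U]%SET) p a = \sum_a p a.
Proof. by apply: eq_bigl => a; rewrite inE. Qed.

Let in_setTE t : [set w | X t w \in [set: U]%SET] = setT.
Proof. by apply/seteqP; split => w //= _; rewrite inE. Qed.

Let sum_p : \sum_a p a = 1.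
Proof.
by have := pX 0 [set: U]%SET; rewrite in_setTE probability_setT sum_setT => -[].
Qed.

Let pstopDq : pstop + q = 1.
Proof. by rewrite -sum_p [RHS](bigID stop). Qed.

Let p_ge0 a : 0 <= p a.
Proof. exact: fine_ge0. Qed.

Let q_ge0 : 0 <= q. Proof. exact: sumr_ge0. Qed.

Let normq_lt1 : `|q| < 1.
Proof. by rewrite ger0_norm // -pstopDq ltrDr. Qed.

(** The event that the epoch reaches time [t]. It also contains the points that never stop, where
    [epoch_length] is 0. *)
Let before (t : nat) : set T := [set w | forall s, (s < t)%N -> ~~ stop (X s w)].

Let set_iota n : [set` iota 0 n] = `I_n.
Proof. by apply/seteqP; split => s; rewrite /mkset mem_iota. Qed.

Let P_before_and t (B : {set U}) :
  P (before t `&` [set w | X t w \in B]) = (q ^+ t * \sum_(a in B) p a)%:E.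
Proof.
(* One family of value sets encodes both events, so independence over the times 0 to [t] factors the
   probability. *)
pose A s := if (s < t)%N then [set a | ~~ stop a]%SET else B.
have -> : before t `&` [set w | X t w \in B] =
    \bigcap_(s in [set` iota 0 t.+1]) [set w | X s w \in A s].
  rewrite set_iota; apply/seteqP; split => w => [[wb wB] s /=|wA].
    rewrite /A ltnS leq_eqVlt => /orP[/eqP->|lt_st]; first by rewrite ltnn.
    by rewrite lt_st inE wb.
  split => [s lt_st|].
    by have := wA s; rewrite /= /A lt_st inE; apply; exact: ltnW.
  by have := wA t; rewrite /= /A ltnn; apply.
rewrite indepX ?iota_uniq // -[t.+1]addn1 iotaD big_cat /= big_seq1 /A ltnn pX.
rewrite (eq_big_seq (fun=> q%:E)); last first.
  move=> s; rewrite mem_iota => /= ->; rewrite pX; congr EFin.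
  by apply: eq_bigl => a; rewrite inE.
rewrite EFinM; congr (_ * _)%E.
rewrite prodEFin; congr EFin.
by rewrite big_const_seq count_predT size_iota iter_mulr_1.
Qed.

Let mbefore t : measurable (before t).
Proof.
rewrite (_ : before t = \bigcap_(s in [set` iota 0 t]) [set w | X s w \in [set a | ~~ stop a]%SET]).
  by apply: bigcap_measurableType => s _; exact: mX.
rewrite set_iota; apply/seteqP; split => w wt s lt_st /=.
  by rewrite inE wt.
by have := wt s lt_st; rewrite /= inE.
Qed.

Let P_before t : P (before t) = (q ^+ t)%:E.
Proof.
have := P_before_and t [set: U]%SET.
by rewrite in_setTE setIT sum_setT sum_p mulr1.
Qed.

Let stops : set T := [set w | exists t, stop (X t w)].

Let mstops : measurable stops.
Proof.
rewrite (_ : stops = \bigcup_t [set w | X t w \in [set a | stop a]%SET]).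
  exact: bigcup_measurable.
by apply/seteqP; split => [w [t wt]|w [t _ /=]]; [exists t => //=|]; rewrite inE // => ?; exists t.
Qed.

(** Never stopping implies [before t] for every [t], and the probabilities [q ^+ t] tend to 0. *)
Let P_nstops : P (~` stops) = 0%E.
Proof.
apply/eqP; rewrite eq_le measure_ge0 andbT.
have cvq : (q ^+ t)%:E @[t --> \oo] --> 0%:E.
  by apply: cvg_EFin; [exact: nearW|exact: cvg_expr].
rewrite -[leRHS]/(0%:E) -(cvg_lim _ cvq) //; apply: lime_ge; first by apply/cvg_ex; exists 0%:E.
apply: nearW => t; rewrite -P_before; apply: le_measure; rewrite ?inE //.
  exact: measurableC.
by move=> w ns s _; apply/negP => ss; apply: ns; exists s.
Qed.

Let P_before_stops t a : fine (P (before t `&` stops `&` [set w | X t w = a])) = q ^+ t * p a.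
Proof.
have mF : measurable (before t `&` [set w | X t w = a]) by exact: measurableI.
rewrite setIAC.
(* The part outside [stops] is negligible, so the value given by [P_before_and] is unchanged. *)
have /(congr1 fine) := measureDI P mF mstops.
rewrite [X in (X + _)%E](_ : _ = 0%E); last first.
  apply/eqP; rewrite eq_le measure_ge0 andbT -P_nstops.
  by apply: le_measure; rewrite ?inE //; [exact: measurableD|exact: measurableC].
rewrite add0e => PF; transitivity (fine (P (before t `&` [set w | X t w = a]))).
  exact: esym PF.
rewrite (_ : [set w | X t w = a] = [set w | X t w \in [set a]%SET]); last first.
  by apply/seteqP; split => w /=; rewrite inE => /eqP.
by rewrite P_before_and big_set1.
Qed.

Variable f : U -> R.

(* Intersecting with [stops] makes the partial sums of Y converge to Z at every
   point, not only almost everywhere, which gives the measurability of Z. *)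
Let Y t w : R := f (X t w) * \1_(before t `&` stops) w.
Let Z w : R := \sum_(t < epoch_length (fun t => stop (X t w))) f (X t w).

Let mBS t : measurable (before t `&` stops).
Proof. exact: measurableI. Qed.

Let sumY_cvg w : (\sum_(t < n) Y t w)%:E @[n --> \oo] --> (Z w)%:E.
Proof.
apply: cvg_near_cst; have [ws|ws] := pselect (stops w); last first.
  (* Off [stops] both sides are 0: the indicators vanish, and so does [epoch_length] by
     convention. *)
  apply: nearW => n; rewrite /Z epoch_length0 // big_ord0 big1 // => t _.
  by rewrite /Y indicE memNset ?mulr0 // => -[].
exists (epoch_length (fun t => stop (X t w))) => // n /= le_n.
congr EFin; rewrite /Z (big_ord_widen _ (fun t => f (X t w)) le_n) [RHS]big_mkcond.
apply: eq_bigr => t _; rewrite /Y indicE.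
case: ifPn => [/(ltn_epoch_length _ ws) bt|nt].
  by rewrite mem_set ?mulr1.
by rewrite memNset ?mulr0 // => -[bt _]; move/negP: nt; apply; apply/(ltn_epoch_length _ ws).
Qed.

(** A uniform bound on [f], available as [U] is finite. The function [g] below is then [B] times the
    epoch length and dominates all partial sums of [Y]. *)
Let B : R := \sum_a `|f a|.
Let g w : \bar R := (\sum_(0 <= t <oo) (B * \1_(before t `&` stops) w)%:E)%E.

Let B_ge0 : 0 <= B. Proof. exact: sumr_ge0. Qed.

Let le_B a : `|f a| <= B.
Proof. by rewrite /B (bigD1 a) //= lerDl; exact: sumr_ge0. Qed.

Let gt_ge0 t w : (0 <= (B * \1_(before t `&` stops) w)%:E)%E.
Proof. by rewrite lee_fin mulr_ge0. Qed.

Let mgt t :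
  measurable_fun setT (fun w => (B * \1_(before t `&` stops) w)%:E).
Proof. exact: measurable_int (integrable_finite_rv P (mX1 0) (fun=> B) (mBS t)). Qed.

Let int_gt t : (\int[P]_w (B * \1_(before t `&` stops) w)%:E = (B * q ^+ t)%:E)%E.
Proof.
rewrite (integral_finite_rv P (mX1 t) (fun=> B) (mBS t)); congr EFin.
under eq_bigr => a _ do rewrite P_before_stops.
by rewrite -mulr_sumr -mulr_sumr sum_p mulr1.
Qed.

(** Termwise integration of the nonnegative series gives a geometric series of ratio [q], and [q] is
    below 1 because stopping has positive probability. *)
Let int_g : P.-integrable setT g.
Proof.
apply/integrableP; split.
  by apply: ge0_emeasurable_sum => // *; exact: gt_ge0.
under eq_integral => w _ do rewrite gee0_abs ?nneseries_ge0 //.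
rewrite integral_nneseries //.
under eq_eseriesr do rewrite int_gt.
have : (\sum_(0 <= t < n) (B * q ^+ t)%:E)%E @[n --> \oo] --> (B / (1 - q))%:E.
  under eq_fun do rewrite sumEFin.
  by apply: cvg_EFin; [exact: nearW|exact: (@cvg_geometric_series _ B q)].
by move/cvg_lim => -> //; rewrite ltry.
Qed.

Let sumY_le n w : (`|(\sum_(t < n) Y t w)%:E| <= g w)%E.
Proof.
apply: le_trans (nneseries_lim_ge n _); last by move=> *; exact: gt_ge0.
rewrite big_mkord sumEFin lee_fin (le_trans (ler_norm_sum _ _ _)) //.
apply: ler_sum => t _; rewrite /Y normrM (ger0_norm (x := \1__ _)) //.
exact: ler_wpM2r.
Qed.

Let int_Y t : P.-integrable setT (fun w => (Y t w)%:E).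
Proof. exact: integrable_finite_rv. Qed.

Let int_sumY n : P.-integrable setT (fun w => (\sum_(t < n) Y t w)%:E).
Proof.
under eq_fun do rewrite -sumEFin.
exact: integrable_sum.
Qed.

Let integral_sumY n : (\int[P]_w (\sum_(t < n) Y t w)%:E =
  (series (geometric (\sum_a f a * p a) q) n)%:E)%E.
Proof.
under eq_integral do rewrite -sumEFin.
rewrite integral_sum // /series /= big_mkord -sumEFin; apply: eq_bigr => t _.
rewrite /Y integral_finite_rv //; congr EFin; rewrite mulr_suml.
apply: eq_bigr => a _; rewrite P_before_stops; ring.
Qed.

(** The term at time [t] has mean [q ^+ t] times the mean of [f], since reaching [t] is independent
    of [X t]. Dominated convergence lets these means be summed over all times. *)
Theorem expectation_stopped_sum :
  ('E_P[fun w => (\sum_(t < epoch_length (fun t => stop (X t w))) f (X t w))%R]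
   = ((\sum_a f a * p a) / pstop)%R%:E)%E.
Proof.
have mZ : measurable_fun setT (fun w => (Z w)%:E).
  apply: (emeasurable_fun_cvg (fun n w => (\sum_(t < n) Y t w)%:E)).
    by move=> n; exact: measurable_int (int_sumY n).
  by move=> w _; exact: sumY_cvg.
have [_ _] := dominated_convergence measurableT
  (fun n => measurable_int _ (int_sumY n)) mZ
  (aeW _ (fun w _ => @sumY_cvg w)) int_g (aeW _ (fun w n _ => sumY_le n w)).
under eq_fun do rewrite integral_sumY.
move=> cvZ; rewrite unlock.
have cvS : (series (geometric (\sum_a f a * p a) q) n)%:E @[n --> \oo]
    --> ((\sum_a f a * p a) / pstop)%:E.
  rewrite (_ : pstop = 1 - q); last by rewrite -pstopDq addrK.
  by apply: cvg_EFin; [exact: nearW|exact: cvg_geometric_series].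
exact: cvg_unique cvZ cvS.
Qed.

End Wald.

(** * Expectations in the two-tier logit model *)

Lemma sum_option (R : nmodType) (U : finType) (F : option U -> R) :
  \sum_o F o = F None + \sum_u F (Some u).
Proof.
rewrite (bigD1 None) //=; congr (_ + _).
rewrite (reindex_omap Some id) /=; last by case.
by apply: eq_bigl => u; rewrite eqxx.
Qed.

Section Model.
Context (R : realType) (K : finType) (r v : K -> R).
Hypothesis v_gt0 : forall i, 0 < v i.
Implicit Types (S : {set K}) (SS : offering K).

Lemma weight_gt0 S : 0 < 1 + \sum_(i in S) v i.
Proof. by rewrite ltr_pwDl // sumr_ge0 // => i _; exact: ltW. Qed.

Lemma sum_mnl_buy S (h : K -> R) :
  \sum_i h i * mnl_buy v S i
    = (\sum_(i in S) h i * v i) / (1 + \sum_(i in S) v i).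
Proof.
rewrite mulr_suml [RHS]big_mkcond; apply: eq_bigr => i _.
by rewrite /mnl_buy; case: ifP; rewrite ?mulr0 // mulrA.
Qed.

Lemma mnl_none_buy S : mnl_none v S + \sum_i mnl_buy v S i = 1.
Proof.
have := sum_mnl_buy S (fun=> 1); under eq_bigr do rewrite mul1r.
under [in X in _ = X -> _]eq_bigr do rewrite mul1r.
by move=> ->; rewrite /mnl_none -[X in X + _]div1r -mulrDl divff // gt_eqF // weight_gt0.
Qed.

(** Reduces a mean over outcomes to single-tier sums; suitable choices of [h] give the expected
    profit and a stopping probability. *)
Lemma sum_smnl (h : outcome K -> R) SS :
  \sum_o h o * smnl_prob v SS o
    = h None * (mnl_none v SS.1 * mnl_none v SS.2)
      + (\sum_i h (Some (inl i)) * mnl_buy v SS.1 i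
         + mnl_none v SS.1 * \sum_i h (Some (inr i)) * mnl_buy v SS.2 i).
Proof.
rewrite sum_option big_sumType /=; congr (_ + (_ + _)).
by rewrite mulr_sumr; apply: eq_bigr => i _; rewrite mulrCA.
Qed.

Lemma sum_smnl_profit SS :
  \sum_o profit_of r o * smnl_prob v SS o = profit2 r v SS.
Proof. by rewrite sum_smnl /= mul0r add0r !sum_mnl_buy. Qed.

Lemma sum_smnl_none_from_tier1 SS :
  \sum_(o | none_from_tier1 o) smnl_prob v SS o
    = (1 + \sum_(i in SS.1) v i)^-1.
Proof.
rewrite big_mkcond (eq_bigr (fun o => (none_from_tier1 o)%:R * smnl_prob v SS o)).
  rewrite sum_smnl /= mul1r [X in _ + (X + _)]big1 ?add0r => [|i _]; last by rewrite mul0r.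
  (* Given no purchase from the first tier, the second-tier probabilities add up to 1. *)
  under eq_bigr do rewrite mul1r.
  by rewrite -mulrDr mnl_none_buy mulr1.
by move=> o _; case: ifP; rewrite ?mul1r ?mul0r.
Qed.

Lemma sum_smnl_none_from_either SS :
  \sum_(o | none_from_either o) smnl_prob v SS o
    = (1 + \sum_(i in SS.1) v i)^-1 * (1 + \sum_(i in SS.2) v i)^-1.
Proof. by rewrite /none_from_either big_pred1_eq. Qed.

Lemma profit1_def S :
  profit1 r v S * (1 + \sum_(i in S) v i) = \sum_(i in S) r i * v i.
Proof. by rewrite /profit1 divfK // gt_eqF // weight_gt0. Qed.

(** Only the first-tier denominator is cleared: offerings sharing a tier then compare by linear
    arithmetic. *)
Lemma profit2_def SS :
  profit2 r v SS * (1 + \sum_(i in SS.1) v i)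
    = \sum_(i in SS.1) r i * v i + profit1 r v SS.2.
Proof.
have w_neq0 : 1 + \sum_(i in SS.1) v i != 0 by rewrite gt_eqF ?weight_gt0.
by rewrite /profit2 -/(profit1 r v SS.2) mulrDl divfK // mulrAC mulVf ?mul1r.
Qed.

(** * Closed forms of the one-epoch regrets *)

Section Epoch.
Context (d : measure_display) (T : measurableType d) (P : probability T R).
Context (c : nat -> T -> customer K).
Hypothesis c_model : iid_smnl_customers v P c.

Let p (a : customer K) : R := fine (P [set w | c 0%N w = a]).

(** Grouping customers by their outcome for [SS] leaves only the marginal law at [SS], whatever the
    coupling between offerings. *)
Lemma sum_customer_outcome SS (h : outcome K -> R) :
  \sum_(a : customer K) h (a SS) * p a = \sum_o h o * smnl_prob v SS o.
Proof.
have mc (a : customer K) : measurable [set w | c 0%N w = a].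
  rewrite (_ : [set _ | _] = [set w | c 0%N w \in [set a]%SET]).
    exact: (customers_measurable c_model).
  by apply/seteqP; split => w /=; rewrite inE => /eqP.
rewrite (partition_big (fun a : customer K => a SS) xpredT) //=.
apply: eq_bigr => o _; rewrite (eq_bigr (fun a => h o * p a)); last first.
  by move=> a /eqP ->.
rewrite -mulr_sumr; congr (_ * _).
have -> : smnl_prob v SS o =
    fine (P [set w | c 0%N w \in [set a : customer K | a SS == o]%SET]).
  rewrite (_ : [set _ | _] = [set w | c 0%N w SS = o]).
    by rewrite (customers_smnl c_model).
  by apply/seteqP; split => w /=; rewrite inE => /eqP.
rewrite prob_finite_rv //; last exact: (customers_measurable c_model).
by apply: eq_bigl => a; rewrite inE.
Qed.

Lemma epoch_regretE (stop : outcome K -> bool) (Sopt SS : offering K) :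
  0 < \sum_(o | stop o) smnl_prob v SS o ->
  epoch_regret r P c stop Sopt SS =
  ((profit2 r v Sopt - profit2 r v SS)
     / \sum_(o | stop o) smnl_prob v SS o)%:E.
Proof.
have <- : \sum_(a : customer K | stop (a SS)) p a =
    \sum_(o | stop o) smnl_prob v SS o.
  rewrite big_mkcond [RHS]big_mkcond /=.
  have /= := sum_customer_outcome SS (fun o => (stop o)%:R).
  under eq_bigr do rewrite mulr_natl mulrb.
  by under [in X in _ = X -> _]eq_bigr do rewrite mulr_natl mulrb.
move=> stop_gt0.
(* Wald's identity is applied to whole customers, as the summand involves their outcomes for both
   [Sopt] and [SS]; linearity then separates the two marginals. *)
rewrite /epoch_regret (@expectation_stopped_sum _ _ _ P _ c
  (customers_measurable c_model) (customers_independent c_model)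
  (customers_identical c_model) (fun a : customer K => stop (a SS)) stop_gt0
  (fun a : customer K => profit_of r (a Sopt) - profit_of r (a SS))).
congr (_ / _)%:E; under eq_bigr do rewrite mulrBl.
by rewrite sumrB !sum_customer_outcome !sum_smnl_profit.
Qed.

(** Multiplying by the mean length clears the first-tier denominator of the enlarged offering; as
    [m] is new there, its weight and profit split off. *)
Lemma regret1E (m : K) (Sopt SS : offering K) : m \notin SS.1 ->
  regret1 r P c m Sopt SS =
  ((1 + \sum_(i in SS.1) v i) * (profit2 r v Sopt - profit2 r v SS)
     + v m * (profit2 r v Sopt - r m))%:E.
Proof.
move=> mS; rewrite /regret1 epoch_regretE; last first.
  by rewrite sum_smnl_none_from_tier1 invr_gt0 weight_gt0.
rewrite sum_smnl_none_from_tier1 invrK; congr EFin.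
rewrite mulrBl (profit2_def (add_tier1 m SS)) /= !big_setU1 //=.
have := profit2_def SS; lra.
Qed.

Lemma regret2E (m : K) (Sopt SS : offering K) : m \notin SS.2 ->
  regret2 r P c m Sopt SS =
  ((1 + \sum_(i in SS.1) v i) * (1 + \sum_(i in SS.2) v i)
       * (profit2 r v Sopt - profit2 r v SS)
     + v m * ((1 + \sum_(i in SS.1) v i) * profit2 r v Sopt
              - \sum_(i in SS.1) r i * v i - r m))%:E.
Proof.
move=> mS; rewrite /regret2 epoch_regretE; last first.
  by rewrite sum_smnl_none_from_either mulr_gt0 // invr_gt0 weight_gt0.
rewrite sum_smnl_none_from_either -invfM invrK; congr EFin.
rewrite mulrBl [X in _ - X]mulrA (profit2_def (add_tier2 m SS)).
rewrite [X in _ - X]mulrDl (profit1_def (add_tier2 m SS).2) /= !big_setU1 //=.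
(* Eliminating the profit numerators of both tiers leaves a polynomial identity. *)
have := profit2_def SS; have := profit1_def SS.2.
set w1 := \sum_(i in SS.1) v i; set w2 := \sum_(i in SS.2) v i.
set rho := profit2 r v SS; set phi := profit1 r v SS.2 => <- /eqP.
rewrite -subr_eq => /eqP <-; ring.
Qed.

End Epoch.
End Model.

(** * Minimizers of the regrets and comparison at the optimum *)

Theorem theorem6p2 (R : realType) (K : finType) (r v : K -> R)
  (X1 X2 : {set K}) (m : K) (Sopt : offering K)
  (d : measure_display) (T : measurableType d) (P : probability T R)
  (c : nat -> T -> customer K)
  (v01 : forall i : K, 0 < v i < 1)
  (m_new : m \notin (X1 :|: X2)%SET)
  (Sopt_optimal : optimal_offerings r v X1 X2 Sopt)
  (rm_lt : r m < profit1 r v Sopt.2)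
  (c_model : iid_smnl_customers v P c) :
  [/\ argmin_offerings X1 X2 (regret1 r P c m Sopt)
        = optimal_offerings r v X1 X2,
      argmin_offerings X1 X2 (regret2 r P c m Sopt)
        = optimal_offerings r v X1 X2,
      (regret2 r P c m Sopt Sopt <= regret1 r P c m Sopt Sopt)%E
    & regret2 r P c m Sopt Sopt = (v m * (profit1 r v Sopt.2 - r m))%:E].
Proof.
have v_gt0 i : 0 < v i by have /andP[] := v01 i.
have w_gt0 := weight_gt0 v_gt0.
have [Sopt_feas Sopt_max] := Sopt_optimal.
have [mX1 mX2] : m \notin X1 /\ m \notin X2.
  by move: m_new; rewrite inE negb_or => /andP.
have m1 SS : feasible X1 X2 SS -> m \notin SS.1.
  by case=> /fintype.subsetP sub1 _; apply: contra mX1 => /sub1.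
have m2 SS : feasible X1 X2 SS -> m \notin SS.2.
  by case=> _ /fintype.subsetP sub2; apply: contra mX2 => /sub2.
have G1 SS (fS : feasible X1 X2 SS) := regret1E r v_gt0 c_model Sopt (m1 _ fS).
have G2 SS (fS : feasible X1 X2 SS) := regret2E r v_gt0 c_model Sopt (m2 _ fS).
have slack_ge SS : feasible X1 X2 SS -> profit1 r v Sopt.2 <=
    (1 + \sum_(i in SS.1) v i) * profit2 r v Sopt - \sum_(i in SS.1) r i * v i.
  move=> [sub1 _]; have fS : feasible X1 X2 (SS.1, Sopt.2).
    by split => //; case: Sopt_feas.
  have := profit2_def r v_gt0 (SS.1, Sopt.2) => /=.
  have := Sopt_max _ fS; rewrite -(ler_pM2r (w_gt0 SS.1)); lra.
have slack_opt : (1 + \sum_(i in Sopt.1) v i) * profit2 r v Sopt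
    - \sum_(i in Sopt.1) r i * v i = profit1 r v Sopt.2.
  by have := profit2_def r v_gt0 Sopt; lra.
have slack_le SS : optimal_offerings r v X1 X2 SS ->
    (1 + \sum_(i in SS.1) v i) * profit2 r v Sopt - \sum_(i in SS.1) r i * v i
    <= profit1 r v Sopt.2.
  move=> [fS S_max].
  (* For optimal [SS] the left side equals [profit1 r v SS.2]; comparing [Sopt] with this mixed
     offering bounds it by [profit1 r v Sopt.2]. *)
  have fS' : feasible X1 X2 (Sopt.1, SS.2) by split; [case: Sopt_feas|case: fS].
  have eqS : profit2 r v SS = profit2 r v Sopt.
    by apply/eqP; rewrite eq_le Sopt_max // S_max.
  have := profit2_def r v_gt0 SS; have := profit2_def r v_gt0 (Sopt.1, SS.2).
  have := Sopt_max _ fS'; rewrite -(ler_pM2r (w_gt0 Sopt.1)) eqS /=; lra.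
(* Criterion for both regrets: [Sopt] minimizes [F], suboptimal offerings are strictly worse, and
   optimal ones are no worse than [Sopt]. *)
have argminE (G : offering K -> \bar R) (F : offering K -> R) :
    (forall SS, feasible X1 X2 SS -> G SS = (F SS)%:E) ->
    (forall SS, feasible X1 X2 SS -> F Sopt <= F SS) ->
    (forall SS, feasible X1 X2 SS -> profit2 r v SS < profit2 r v Sopt ->
       F Sopt < F SS) ->
    (forall SS, optimal_offerings r v X1 X2 SS -> F SS <= F Sopt) ->
    argmin_offerings X1 X2 G = optimal_offerings r v X1 X2.
  move=> GF F_ge F_gt F_le; apply/seteqP; split => SS [fS S_best]; split => //.
    move=> SS' /Sopt_max /le_trans; apply; rewrite leNgt; apply/negP.
    move=> /(F_gt _ fS); have := S_best _ Sopt_feas.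
    by rewrite !GF // lee_fin => /le_lt_trans/[apply]; rewrite ltxx.
  move=> SS' fS'; rewrite !GF // lee_fin.
  by apply: le_trans (F_ge _ fS'); apply: F_le; split.
split.
- apply: argminE G1 _ _ _ => [SS fS|SS fS lt|SS [fS S_max]].
  + by rewrite subrr mulr0 lerD2r mulr_ge0 ?(ltW (w_gt0 _)) ?subr_ge0 ?Sopt_max.
  + by rewrite subrr mulr0 ltrD2r mulr_gt0 // subr_gt0.
  + by rewrite subrr mulr0 lerD2r pmulr_rle0 // subr_le0 S_max.
- apply: argminE G2 _ _ _ => [SS fS|SS fS lt|SS oS].
  (* The two summands are compared separately: the profit gap by optimality of [Sopt], the
     coefficient of [v m] by the slack bounds. *)
  + rewrite subrr mulr0 slack_opt lerD //.
      by rewrite !mulr_ge0 ?(ltW (w_gt0 _)) ?subr_ge0 ?Sopt_max.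
    by rewrite ler_pM2l // lerD2r slack_ge.
  + rewrite subrr mulr0 slack_opt ltr_leD //.
      by rewrite !mulr_gt0 // subr_gt0.
    by rewrite ler_pM2l // lerD2r slack_ge.
  + rewrite subrr mulr0 slack_opt lerD //.
      by rewrite pmulr_rle0 ?mulr_gt0 // subr_le0; case: oS => _; apply.
    by rewrite ler_pM2l // lerD2r slack_le.
- rewrite G1 // G2 // slack_opt lee_fin !subrr !mulr0 !add0r ler_pM2l //.
  rewrite lerD2r.
  have f0 : feasible X1 X2 (finset.set0, Sopt.2).
    by split; [exact: finset.sub0set|case: Sopt_feas].
  (* With an empty first tier, [profit2] reduces to [profit1] of the second. *)
  have := Sopt_max _ f0; have := profit2_def r v_gt0 (finset.set0, Sopt.2).
  by rewrite /= !big_set0; lra.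
- by rewrite G2 // slack_opt subrr mulr0 add0r.
Qed.
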